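(* Let $N \geq 2$. The optimal $k$-positional strategy for the game of best choice restricted to the $321$-avoiding interview rank orders of size $N$ is given by $$k = \begin{cases} N-1 & \text{if } N = 2, \\ N-2 & \text{if } 3 \leq N \leq 8, \\ N-3 & \text{otherwise.} \end{cases}$$ The asymptotic probability of success (the limit as $N \to \infty$ of the success probability of this optimal strategy) is $$\lim_{N \rightarrow \infty} \frac{3C_{N-1}-4C_{N-2}-C_{N-3}}{C_N} = \frac{31}{64} = 0.484375.$$
   Context: $C_n = \frac{1}{n+1}\binom{2n}{n}$ denotes the $n$th Catalan number. A permutation (interview rank order) of size $N$ is an arrangement $p_1 p_2 \cdots p_N$ of the values $1,2,\ldots,N$. It is $321$-avoiding if there do not exist $i<j<l$ with $p_i>p_j>p_l$; there are $C_N$ such permutations. A left-to-right maximum of $p$ is an entry $p_j$ with $p_j > p_i$ for all $i<j$. In the game of best choice restricted to $321$-avoiding rank orders, $p$ is chosen uniformly at random among the $321$-avoiding permutations of size $N$. The $k$-positional strategy rejects $p_1,\ldots,p_k$ and then accepts the next left-to-right maximum of $p$ in a position $>k$; it succeeds (wins) on $p$ if the accepted entry is the value $N$, in which case $p$ is called $k$-winnable. The success probability of the $k$-positional strategy is the number of $k$-winnable $321$-avoiding permutations of size $N$ divided by $C_N$. A value of $k$ is optimal if its success probability is the maximum over all $k$-positional strategies, $0 \leq k \leq N-1$. *)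

(* Defs.v *)
From mathcomp Require Import all_boot all_order all_algebra perm.
From mathcomp Require Import reals topology normedtype.

Set Implicit Arguments.
Unset Strict Implicit.
Unset Printing Implicit Defensive.

Import Order.TTheory GRing.Theory Num.Theory.

Local Open Scope ring_scope.

(* An interview rank order p_1 ... p_N is a permutation p : 'S_N, with positions
   and values both shifted down by one: p_(i+1) = (p i).+1.  In particular the
   best candidate, of value N, is the one with (p i).+1 = N, and the first k
   positions are those i : 'I_N with i < k. *)

Definition avoids321 (N : nat) (p : 'S_N) : bool :=
  [forall i : 'I_N, forall j : 'I_N, forall l : 'I_N,
     ~~ [&& (i < j)%N, (j < l)%N, (p j < p i)%N & (p l < p j)%N]].

Definition lr_max (N : nat) (p : 'S_N) (j : 'I_N) : bool :=
  [forall i : 'I_N, (i < j)%N ==> (p i < p j)%N].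

Definition accepts (N : nat) (p : 'S_N) (k : nat) (j : 'I_N) : bool :=
  [&& (k <= j)%N, lr_max p j
    & [forall i : 'I_N, (k <= i < j)%N ==> ~~ lr_max p i]].

(* False when the strategy accepts nobody. *)
Definition winnable (N : nat) (p : 'S_N) (k : nat) : bool :=
  [exists j : 'I_N, accepts p k j && ((p j).+1 == N)].

Definition catalan (R : realType) (n : nat) : R :=
  (n.+1%:R)^-1 * 'C(2 * n, n)%:R.

Definition success_prob (R : realType) (N k : nat) : R :=
  #|[set p : 'S_N | avoids321 p && winnable p k]|%:R / catalan R N.

Definition optimal (R : realType) (N k : nat) : Prop :=
  (k <= N - 1)%N /\
  forall k' : nat, (k' <= N - 1)%N ->
    success_prob R N k' <= success_prob R N k.

Definition k_opt (N : nat) : nat :=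
  if N == 2%N then (N - 1)%N
  else if (3 <= N <= 8)%N then (N - 2)%N
  else (N - 3)%N.

(* Main.v *)
Require Import Defs.
From mathcomp Require Import all_boot all_order all_algebra perm.
From mathcomp Require Import boolp reals topology normedtype sequences.
From mathcomp Require Import ring lra zify.

Set Implicit Arguments.
Unset Strict Implicit.
Unset Printing Implicit Defensive.

(** The k-positional strategy wins on p exactly when p has a single
    left-to-right maximum among the positions from k on: the position of the
    best candidate is always the last left-to-right maximum.  On the other
    hand p avoids 321 exactly when each entry is a left-to-right maximum or
    smaller than everything after it ([avoids321E]).  So if a 321-avoiding p
    is revealed from left to right, all that matters after i entries is the
    height m, the largest value seen (counted from 1): the next entry
    is either one of the values above m, or the least value not seen so far,
    and the latter is below m exactly when i < m.  Recording the successive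
    heights turns 321-avoiding permutations into lattice paths that stay
    weakly above the diagonal, and [sum_avoids321] counts such permutations
    with weights depending on the pattern of left-to-right maxima.

    Let [ballot k m] be the number of height sequences of length k that end
    at m.  To win with such a prefix, m < N, the height must stay at m until
    it jumps to N at some position j with k <= j <= m, which leaves m + 1 - k
    choices.  Hence the number of k-winnable permutations is
      wins N k = \sum_(k <= m < N) (m + 1 - k) * ballot k m,
    which is [card_winnable].  The numbers [ballot k m] obey the usual
    recurrence and closed form of ballot numbers, and [ballot n n] is the
    Catalan number C_n.

    For k <= N - 4, [wins N k] is less than [wins N k.+1]
    ([wins_increasing]): by induction on N this follows from the recurrence
    as soon as a row of the ballot triangle never grows by more than a factor
    3 from one entry to the next ([leq_ballot3]).  Only k = N - 1, N - 2 and
    N - 3 remain, where the number of wins is respectively C_(N-1),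
    2 C_(N-1) - C_(N-2) and 3 C_(N-1) - 4 C_(N-2) - C_(N-3).  The second beats
    the first when N >= 3, and with n = N - 3 the third beats the second when
    3 n^2 - 15 n - 12 > 0, that is when N >= 9, and loses otherwise.  The limit
    follows from C_n / C_(n+1) --> 1/4. *)

(** * Revealing a 321-avoiding permutation from left to right *)

Definition rl_min (N : nat) (p : 'S_N) (j : 'I_N) : bool :=
  [forall l : 'I_N, (j < l) ==> (p j < p l)].

(** An entry that has both a larger entry before it and a smaller one after it
    is the middle of a 321 pattern, and conversely. *)
Lemma avoids321E (N : nat) (p : 'S_N) :
  avoids321 p = [forall j : 'I_N, lr_max p j || rl_min p j].
Proof.
apply/idP/idP => [/forallP av | /forallP ok].
  apply/forallP=> j; apply/norP => -[/forallPn[i]]; rewrite negb_imply.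
  move=> /andP[ij pji] /forallPn[l]; rewrite negb_imply => /andP[jl plj].
  have /forallP/(_ j)/forallP/(_ l)/negP := av i; apply.
  rewrite ij jl /=.
  have neq (a b : 'I_N) : a < b -> p a != p b :> nat.
    by apply: contraTN => /eqP/val_inj/perm_inj->; rewrite ltnn.
  have := neq _ _ ij; have := neq _ _ jl; lia.
apply/forallP=> i; apply/forallP=> j; apply/forallP=> l.
apply/negP=> /and4P[ij jl pji plj].
case/orP: (ok j) => /forallP; first by move=> /(_ i); rewrite ij /=; lia.
by move=> /(_ l); rewrite jl /=; lia.
Qed.

(** The largest of the first i values, counted from 1, so that the height of the
    empty prefix is 0. *)
Definition run_max (N : nat) (p : 'S_N) (i : nat) : nat :=
  \max_(j < N | j < i) (p j).+1.

Lemma run_max0 (N : nat) (p : 'S_N) : run_max p 0 = 0.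
Proof. by rewrite /run_max big_pred0. Qed.

Lemma run_maxS (N : nat) (p : 'S_N) (i : 'I_N) :
  run_max p i.+1 = maxn (run_max p i) (p i).+1.
Proof.
rewrite /run_max (bigD1 i) //= maxnC; congr maxn; apply: eq_bigl => j.
by rewrite -val_eqE /=; lia.
Qed.

Lemma lr_maxE (N : nat) (p : 'S_N) (i : 'I_N) :
  lr_max p i = (run_max p i <= p i).
Proof.
apply/forallP/bigmax_leqP => [lr j | lr j]; first by move=> ji; have := lr j; rewrite ji.
by apply/implyP => /lr.
Qed.

Lemma run_max_le (N : nat) (p : 'S_N) (i : nat) : run_max p i <= N.
Proof. by apply/bigmax_leqP. Qed.

Definition agree (N i : nat) (p q : 'S_N) : bool :=
  [forall j : 'I_N, (j < i) ==> (p j == q j)].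

Lemma agreeP (N i : nat) (p q : 'S_N) :
  reflect (forall j : 'I_N, j < i -> p j = q j) (agree i p q).
Proof.
by apply: (iffP forallP) => H j; [move=> ji; have := H j; rewrite ji => /eqP | apply/implyP=> /H->].
Qed.

Lemma agree_run_max (N i : nat) (p q : 'S_N) :
  agree i p q -> run_max p i = run_max q i.
Proof. by move=> /agreeP pq; apply: eq_bigr => j /pq->. Qed.

Lemma card_lt_ord (N i : nat) : i <= N -> #|[set j : 'I_N | j < i]| = i.
Proof.
by move=> iN; rewrite -sum1dep_card -(big_ord_widen N (fun=> 1) iN) sum1_card card_ord.
Qed.

Lemma run_max_fresh (N : nat) (q : 'S_N) (i l : 'I_N) :
  run_max q i <= q l -> i <= l.
Proof.
by move/bigmax_leqP=> H; rewrite leqNgt; apply/negP=> /H; rewrite ltnn.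
Qed.

(** The values below the height m that are missing from a prefix of length i are
    m - i in number: [small_suffix] and [suffix_small] say that one exists
    exactly when i < m. *)
Lemma small_suffix (N : nat) (q : 'S_N) (i l : 'I_N) :
  i <= l -> q l < run_max q i -> i < run_max q i.
Proof.
move=> il ql.
have : #|q @: [set j : 'I_N | (j < i) || (j == l)]| <= run_max q i.
  rewrite -[leqRHS](card_lt_ord (run_max_le q i)); apply: subset_leq_card.
  apply/subsetP => v /imsetP[j]; rewrite !inE => /orP[ji | /eqP->] -> //.
  by rewrite /run_max (bigD1 j) //= leq_max leqnn.
rewrite (card_imset _ (@perm_inj _ q)); apply: leq_trans.
have -> : [set j : 'I_N | (j < i) || (j == l)] = l |: [set j : 'I_N | j < i].
  by apply/setP=> j; rewrite !inE orbC.
by rewrite cardsU1 inE -leqNgt il card_lt_ord // ltnW.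
Qed.

Lemma suffix_small (N : nat) (q : 'S_N) (i : 'I_N) :
  i < run_max q i -> exists2 l : 'I_N, i <= l & q l < run_max q i.
Proof.
move=> im; have [l /andP[]|noone] := pickP [pred l : 'I_N | (i <= l) && (q l < run_max q i)].
  by exists l.
suff: run_max q i <= i by lia.
rewrite -[leqLHS](card_lt_ord (run_max_le q i)) -[leqRHS](card_lt_ord (ltnW (ltn_ord i))).
rewrite -(card_imset [set j : 'I_N | j < i] (@perm_inj _ q)).
apply: subset_leq_card; apply/subsetP => v; rewrite inE => vm.
apply/imsetP; exists (q^-1%g v); last by rewrite permKV.
by rewrite inE; have := noone (q^-1%g v); rewrite /= permKV vm andbT; lia.
Qed.

(** The weighted number of ways to reveal r more entries, when i entries of
    height m have been revealed and an entry at position j has weight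
    [w j true] if it is a left-to-right maximum and [w j false] otherwise.  The
    first term reveals the least missing value when it is below m, and v is the
    value of a new left-to-right maximum. *)
Fixpoint completions (w : nat -> bool -> nat) (r i m : nat) : nat :=
  if r is r'.+1 then
    (i < m) * (w i false * completions w r' i.+1 m)
    + \sum_(m <= v < i + r) w i true * completions w r' i.+1 v.+1
  else 1.

Definition suffix_ok (N i : nat) (p : 'S_N) : bool :=
  [forall j : 'I_N, (i <= j) ==> (lr_max p j || rl_min p j)].

Lemma suffix_okS (N : nat) (i : 'I_N) (p : 'S_N) :
  suffix_ok i p = (lr_max p i || rl_min p i) && suffix_ok i.+1 p.
Proof.
apply/forallP/andP => [ok | [oki /forallP ok] j].
  split; first by have := ok i; rewrite leqnn.
  by apply/forallP=> j; apply/implyP=> ij; have := ok j; rewrite ltnW.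
apply/implyP; rewrite leq_eqVlt => /orP[/eqP/val_inj<- // | ij].
by have := ok j; rewrite ij.
Qed.

(** Prescribing one more entry of p, namely the value that q has at a later
    position l, amounts to agreeing with q in which positions i and l have been
    exchanged.  Thus prefixes are represented by permutations throughout. *)
Lemma agreeS (N : nat) (i l : 'I_N) (p q : 'S_N) : i <= l ->
  agree i p q && (p i == q l) = agree i.+1 p (tperm i l * q)%g.
Proof.
move=> il.
have fixt (j : 'I_N) : j < i -> tperm i l j = j.
  by move=> ji; rewrite tpermD // -val_eqE /=; lia.
apply/andP/agreeP => [[/agreeP pq /eqP pi] j | pq].
  rewrite ltnS leq_eqVlt permM => /orP[/eqP/val_inj->|ji]; first by rewrite tpermL.
  by rewrite fixt // pq.
split; last by rewrite pq // permM tpermL.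
by apply/agreeP => j ji; rewrite pq 1?ltnW // permM fixt.
Qed.

(** Permutations that agree on a prefix have the same set of values after it, so
    whether p i is a right-to-left minimum can be read off q. *)
Lemma agree_rl_min (N : nat) (i l : 'I_N) (p q : 'S_N) : i <= l ->
  agree i p q -> p i = q l ->
  rl_min p i = [forall j : 'I_N, (i <= j) ==> (q l <= q j)].
Proof.
move=> il /agreeP pq pil; apply/forallP/forallP => H j; apply/implyP => ij.
  pose j' := p^-1%g (q j); have pj' : p j' = q j by rewrite permKV.
  have ij' : i <= j'.
    rewrite leqNgt; apply/negP=> ji; move: pj'; rewrite pq // => /perm_inj e.
    by move: ji; rewrite e; lia.
  move: ij'; rewrite -pj' -pil leq_eqVlt => /orP[/eqP/val_inj-> // | ij'].
  by have := H j'; rewrite ij' /=; apply: ltnW.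
pose j' := q^-1%g (p j); have qj' : q j' = p j by rewrite permKV.
have ij' : i <= j'.
  rewrite leqNgt; apply/negP=> ji; move: qj'; rewrite -pq // => /perm_inj e.
  by move: ji; rewrite e; lia.
have := H j'; rewrite ij' qj' -pil /= leq_eqVlt => /orP[/eqP/val_inj/perm_inj e|//].
by move: ij; rewrite e ltnn.
Qed.

(** The induction step sorts the permutations by the position l that their i-th
    value has in q.  A value above the height of the prefix can always be
    used; a value below it only when it is the least of the remaining ones. *)
Lemma sum_completions (N : nat) (w : nat -> bool -> nat) (r i : nat) (q : 'S_N) :
  i + r = N ->
  \sum_(p : 'S_N | agree i p q && suffix_ok i p)
     \prod_(j < N | i <= j) w j (lr_max p j)
  = completions w r i (run_max q i).
Proof.
elim: r i q => [|r IH] i q irN.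
  rewrite (big_pred1 q) => [|p].
    by rewrite big_pred0 // => j; have := ltn_ord j; lia.
  apply/andP/eqP => [[/agreeP pq _] | ->].
    by apply/permP => j; apply: pq; have := ltn_ord j; lia.
  by split; [apply/agreeP | apply/forallP=> j; have := ltn_ord j; case: leqP; lia].
have iN : i < N by lia.
pose i0 := Ordinal iN; set m := run_max q i.
have iS : i.+1 + r = N by lia.
have mN : m <= N := run_max_le q i.
(* l = q^-1 (p i) is the position in q of the value that p puts at i. *)
rewrite (partition_big (fun p : 'S_N => q^-1%g (p i0)) (fun l => i <= l)) /=; last first.
  move=> p /andP[/agreeP pq _]; rewrite leqNgt; apply/negP => lt.
  have := pq _ lt; rewrite permKV => /perm_inj e.
  by move: lt; rewrite e /= ltnn.
pose c := completions w r i.+1.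
pose least l := [forall j : 'I_N, (i <= j) ==> (q l <= q j)].
transitivity (\sum_(l < N | i <= l)
   if m <= q l then w i true * c (q l).+1
   else if least l then w i false * c m else 0).
  apply: eq_bigr => l il.
  have cls p : (agree i p q && suffix_ok i p && (q^-1%g (p i0) == l)) =
     ((m <= q l) || least l) &&
     (agree i.+1 p (tperm i0 l * q)%g && suffix_ok i.+1 p).
    rewrite -(@agreeS _ i0) // (canF_eq (permKV q)) (suffix_okS i0).
    case: (boolP (agree i p q)) => [ag|_]; last by rewrite andbF.
    case: (p i0 =P q l) => [pil|_]; last by rewrite !andbF.
    rewrite lr_maxE (agree_run_max ag) (@agree_rl_min _ i0 l p q) // pil.
    by rewrite andbT /= ?andbT.
  rewrite (eq_bigl _ _ cls).
  have rm : run_max (tperm i0 l * q)%g i.+1 = maxn m (q l).+1.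
    rewrite (run_maxS _ i0) permM tpermL; congr maxn.
    apply: agree_run_max; apply/agreeP => j ji.
    by rewrite permM tpermD // -val_eqE /= eq_sym ltn_eqF // (leq_trans ji).
  have prodS p : agree i.+1 p (tperm i0 l * q)%g ->
    \prod_(j < N | i <= j) w j (lr_max p j) =
    w i (m <= q l) * \prod_(j < N | i < j) w j (lr_max p j).
    rewrite -(@agreeS _ i0) // => /andP[ag /eqP pil].
    rewrite (bigD1 i0) //= lr_maxE (agree_run_max ag) pil; congr (_ * _).
    by apply: eq_bigl => j; rewrite -val_eqE /=; lia.
  case: (boolP (m <= q l)) => ml /=.
    under eq_bigr => p /andP[ag _] do rewrite (prodS _ ag) ml.
    by rewrite -big_distrr IH // rm /c (maxn_idPr _) // ltnW.
  case: (boolP (least l)) => ll /=; last by rewrite big_pred0.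
  under eq_bigr => p /andP[ag _] do rewrite (prodS _ ag) (negbTE ml).
  by rewrite -big_distrr IH // rm /c (maxn_idPl _) //; lia.
rewrite (bigID (fun l : 'I_N => q l < m)) /=; congr (_ + _).
  case: (ltnP i m) => im /=; last first.
    rewrite mul0n big_pred0 // => l; apply/negP=> /andP[il].
    by move/(@small_suffix _ q i0 l il); rewrite ltnNge im.
  rewrite mul1n; have [l0 il0 l0m] := @suffix_small _ q i0 im.
  pose l := [arg min_(l < l0 | i <= l) nat_of_ord (q l)].
  have [il lmin] : i <= l /\ forall j : 'I_N, i <= j -> q l <= q j.
    by rewrite /l; case: arg_minnP => // a ia amin; split.
  have lm : q l < m by apply: leq_ltn_trans (lmin _ il0) l0m.
  rewrite (bigD1 l) /=; last by rewrite il.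
  rewrite leqNgt lm /=.
  have -> : least l by apply/forallP=> j; apply/implyP=> /lmin.
  rewrite big1 ?addn0 // => a /andP[/andP[ia am] al].
  rewrite leqNgt am /=; case: ifP => // /forallP/(_ l); rewrite il /= => le.
  have /val_inj/perm_inj e : q a = q l :> nat by have := lmin _ ia; lia.
  by rewrite e eqxx in al.
(* Reindexed by the value v = q l: every value above the height is unused. *)
rewrite irN (big_nat_widenl _ 0) // big_mkord.
rewrite (reindex_inj (@perm_inj _ q^-1%g)) /=.
apply: eq_big => [v|v]; rewrite permKV -leqNgt; last by case/andP=> _ ->.
rewrite andbC; case: (leqP m v) => //= mv.
by apply: (@run_max_fresh _ q i0); rewrite permKV.
Qed.

Lemma sum_avoids321 (N : nat) (w : nat -> bool -> nat) :
  \sum_(p : 'S_N | avoids321 p) \prod_(j < N) w j (lr_max p j)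
  = completions w N 0 0.
Proof.
rewrite -[X in completions _ _ _ X](run_max0 (1%g : 'S_N)) -sum_completions //.
apply: eq_bigl => p; rewrite avoids321E.
by have -> : agree 0 p 1%g by apply/agreeP.
Qed.

(** * Counting winnable permutations *)

(** The weight that selects the permutations whose only left-to-right maximum at
    a position >= k is at position j0. *)
Definition only_record (k j0 j : nat) (b : bool) : nat :=
  (k <= j) ==> (b == (j == j0)).

Lemma top_lr_max (N : nat) (p : 'S_N) (j : 'I_N) : (p j).+1 = N -> lr_max p j.
Proof.
move=> pj; apply/forallP=> i; apply/implyP=> ij.
have : p i != p j by apply: contraTneq ij => /perm_inj->; rewrite ltnn.
by rewrite -val_eqE /=; have := ltn_ord (p i); lia.
Qed.

Lemma lr_max_ltn (N : nat) (p : 'S_N) (i j : 'I_N) :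
  lr_max p j -> i < j -> p i < p j.
Proof. by move=> /forallP/(_ i)/implyP. Qed.

(** The accepted entry is the first left-to-right maximum from k on, and the best
    candidate is the last one: winning means that they are the only one, and the
    sum over j0 locates it. *)
Lemma winnable_only_record (N : nat) (p : 'S_N) (k : nat) :
  winnable p k = \sum_(j0 < N | k <= j0) \prod_(j < N) only_record k j0 j (lr_max p j) :> nat.
Proof.
pose only (j0 : 'I_N) := [forall j : 'I_N, (k <= j) ==> (lr_max p j == (j == j0))].
have prodE (j0 : 'I_N) : \prod_(j < N) only_record k j0 j (lr_max p j) = only j0.
  rewrite /only; case: forallP => [H | /forallP/forallPn[j nj]].
    by rewrite big1 // => j _; rewrite /only_record; have := H j; rewrite -val_eqE => ->.
  by rewrite (bigD1 j) //= /only_record -[j == j0 :> nat]/(j == j0) (negbTE nj) mul0n.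
have only_uniq (a b : 'I_N) : k <= b -> only a -> only b -> a = b.
  move=> kb /forallP/(_ b) + /forallP/(_ b); rewrite kb eqxx /= => /eqP-> /eqP.
  by move/eqP.
have onlyP (a : 'I_N) : k <= a -> accepts p k a && ((p a).+1 == N) = only a.
  move=> ka; apply/andP/forallP => [[/and3P[_ la /forallP na] /eqP pa] j | oa].
    apply/implyP=> kj; have [ja | aj | /val_inj->] := ltngtP j a.
    - by have := na j; rewrite kj ja /= => /negbTE->; rewrite -val_eqE /= ltn_eqF.
    - rewrite -val_eqE /= gtn_eqF //; apply/eqP/negbTE/negP => /lr_max_ltn /(_ aj).
      by have := ltn_ord (p j); lia.
    - by rewrite la eqxx.
  have la : lr_max p a by have := oa a; rewrite ka eqxx => /eqP->.
  split.
    rewrite /accepts ka la /=; apply/forallP=> j; apply/implyP=> /andP[kj ja].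
    by have := oa j; rewrite kj /= => /eqP->; rewrite -val_eqE /= ltn_eqF.
  have N0 : N.-1 < N by have := ltn_ord a; lia.
  pose t := p^-1%g (Ordinal N0).
  have pt : (p t).+1 = N by rewrite permKV /=; lia.
  have at_ : a <= t.
    rewrite leqNgt; apply/negP => /(lr_max_ltn la); have := ltn_ord (p a); lia.
  have := oa t; rewrite (leq_trans ka at_) top_lr_max //= => /eqP/esym/eqP e.
  by rewrite -e pt.
under eq_bigr => j0 _ do rewrite prodE.
rewrite /winnable; case: existsP => [[a /andP[acc pa]]|none].
  have ka : k <= a by case/and3P: acc.
  have oa : only a by rewrite -onlyP // acc.
  rewrite (bigD1 a) //= oa big1 // => b /andP[kb ba]; apply/eqP; rewrite eqb0.
  by apply: contra ba => /(only_uniq _ _ kb oa)->.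
rewrite big1 // => a ka; rewrite -onlyP //; apply/eqP; rewrite eqb0.
by apply/negP=> Ha; apply: none; exists a.
Qed.

(** After the position j0 of the jump the height stays at its value, which must be
    N.  Before it the height must stay at m < N up to position j0, and
    staying at m is possible at the positions below m, whence j0 <= m. *)
Lemma completions_only_record (N k j0 r i m : nat) :
  k <= j0 -> j0 < N -> i + r = N -> k <= i -> i <= m <= N ->
  completions (only_record k j0) r i m =
  (if j0 < i then m == N else j0 <= m < N) :> nat.
Proof.
move=> kj jN; elim: r i m => [|r IH] i m irN ki /andP[im mN] /=.
  by have -> : j0 < i; [lia | have -> : m == N by lia].
rewrite !/(only_record k j0 i _) ki /= irN.
have -> : (i < m) * ((false == (i == j0)) * completions (only_record k j0) r i.+1 m)
   = (i < m) * (i != j0) * (if j0 < i.+1 then m == N else j0 <= m < N).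
  case: (ltnP i m) => im'; last by rewrite !mul0n.
  by rewrite !mul1n IH; [case: (i == j0) | lia..].
have -> : \sum_(m <= v < N) (true == (i == j0)) * completions (only_record k j0) r i.+1 v.+1
   = (i == j0) * (m < N).
  case: (i =P j0) => [e | _]; last by rewrite big1.
  rewrite mul1n; case: (ltnP m N) => mN'; last by rewrite big_geq.
  have N0 : N = N.-1.+1 by lia.
  rewrite {1}N0 big_nat_recr /=; last lia.
  rewrite big_nat big1 => [|v /andP[mv vN]].
    by rewrite IH; [have -> : j0 < i.+1 by lia | lia..]; rewrite -N0 eqxx.
  by rewrite IH; [have -> : j0 < i.+1 by lia | lia..]; rewrite ltn_eqF //; lia.
by case: (ltngtP i j0) => ij; case: (ltnP i m); case: (ltnP j0 i.+1);
   case: (m =P N); case: (ltnP m N); case: (leqP j0 m); lia.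
Qed.

(** The number of weakly increasing sequences of k heights ending at m, in which
    the i-th height is at least i; for k = 0 the height is 0. *)
Fixpoint ballot (k m : nat) : nat :=
  if k is k'.+1 then if k <= m then \sum_(j < m.+1) ballot k' j else 0
  else m == 0.
Arguments ballot : simpl never.

Lemma ballot_small (k m : nat) : m < k -> ballot k m = 0.
Proof. by case: k => // k mk; rewrite /ballot leqNgt mk. Qed.

Lemma ballotS (k m : nat) : k < m ->
  ballot k.+1 m = \sum_(k <= j < m.+1) ballot k j.
Proof.
move=> km; rewrite [LHS]/ballot -/ballot km -(big_mkord xpredT (ballot k)).
rewrite (big_cat_nat (n := k)) //=; last lia.
by rewrite big_nat big1 ?add0n // => j /andP[_ /ballot_small].
Qed.

(** All weights are 1 on the first k positions, so the recursion of [completions]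
    may be unrolled k times; collecting the final heights gives the recursion
    of [ballot]. *)
Lemma completions_ballot (N k j0 : nat) : k <= N ->
  completions (only_record k j0) N 0 0 =
  \sum_(k <= m < N.+1) ballot k m * completions (only_record k j0) (N - k) k m.
Proof.
move=> kN; set w := only_record k j0.
suff H i : i <= k -> completions w N 0 0 =
  \sum_(i <= m < N.+1) ballot i m * completions w (N - i) i m by exact: H.
elim: i => [_|i IH ik].
  rewrite big_nat_recl // subn0 mul1n big1 ?addn0 // => j _.
have wi b : w i b = 1 by rewrite /w /only_record leqNgt ik.
have e : N - i = (N - i.+1).+1 by lia.
rewrite IH ?e /=; last exact: ltnW.
have -> : i + (N - i.+1).+1 = N by lia.
pose c := completions w (N - i.+1) i.+1.
under eq_bigr => m _ do rewrite !wi mul1n.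
transitivity (\sum_(i <= m < N.+1) \sum_(i.+1 <= v < N.+1 | m <= v) ballot i m * c v).
  rewrite big_nat [RHS]big_nat; apply: eq_bigr => m /andP[im mN].
  rewrite -[RHS]big_distrr /=; congr (_ * _).
  under eq_bigr => v _ do rewrite mul1n.
  rewrite -(big_add1 _ _ m N.+1 xpredT c).
  case: (ltnP i m) => im'.
    rewrite mul1n -big_ltn // (big_nat_widenl _ i.+1) //; exact: ltnW.
  have -> : m = i by lia.
  by rewrite mul0n add0n big_nat_cond [RHS]big_nat_cond; apply: eq_bigl => v; lia.
rewrite (exchange_big_dep_nat xpredT) //= !big_nat; apply: eq_bigr => v /andP[iv vN].
rewrite -big_distrl /= -/(c v); congr (_ * _).
rewrite ballotS // [RHS](big_nat_widen _ _ N.+1) //; apply: eq_bigl => j; lia.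
Qed.

Definition wins (N k : nat) : nat := \sum_(k <= m < N) (m.+1 - k) * ballot k m.

(** For a prefix of height m < N the admissible positions of the best candidate
    are k, ..., m. *)
Lemma card_winnable (N k : nat) : k < N ->
  #|[set p : 'S_N | avoids321 p && winnable p k]| = wins N k.
Proof.
move=> kN; rewrite -sum1dep_card big_mkcondr /=.
transitivity (\sum_(p : 'S_N | avoids321 p) \sum_(j0 < N | k <= j0)
     \prod_(j < N) only_record k j0 j (lr_max p j)).
  by apply: eq_bigr => p _; rewrite -winnable_only_record; case: winnable.
rewrite exchange_big /=.
transitivity (\sum_(j0 < N | k <= j0) \sum_(k <= m < N | j0 <= m) ballot k m).
  apply: eq_bigr => j0 kj; rewrite sum_avoids321 completions_ballot; last exact: ltnW.
  rewrite big_nat_recr /=; last exact: ltnW.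
  rewrite (@completions_only_record N) ?ltn_ord //; try lia.
  rewrite ltnNge kj /= ltnn andbF muln0 addn0 [RHS]big_mkcond /= big_nat [RHS]big_nat.
  apply: eq_bigr => m /andP[km mN].
  rewrite (@completions_only_record N) ?ltn_ord //; try lia.
  by rewrite ltnNge kj /= mN andbT; case: leqP; rewrite ?muln1 ?muln0.
rewrite (exchange_big_dep xpredT) //= /wins big_nat [RHS]big_nat.
apply: eq_bigr => m /andP[km mN]; rewrite sum_nat_const; congr (_ * _).
rewrite -sum1_card -(big_mkord (fun j => (k <= j) && (j <= m)) (fun=> 1)).
rewrite -[RHS]muln1 -sum_nat_const_nat.
rewrite [RHS](big_nat_widenl _ 0) // [RHS](big_nat_widen _ _ N) //.
Qed.

(** * Ballot numbers and Catalan numbers *)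

Lemma ballot_diag (k : nat) : ballot k.+1 k.+1 = ballot k k + ballot k k.+1.
Proof. by rewrite ballotS // big_ltn // big_nat1. Qed.

Lemma ballot_rec (k m : nat) : k < m ->
  ballot k.+1 m.+1 = ballot k.+1 m + ballot k m.+1.
Proof.
move=> km; rewrite [LHS]ballotS; last exact: ltnW.
by rewrite ballotS // big_nat_recr //= ltnW // ltnW.
Qed.

(** The reflection principle: among all lattice paths, those that cross the
    diagonal are counted by the second binomial coefficient.  Writing it as
    ['C(k + m, m.+1)] rather than ['C(k + m, k.-1)] makes the case k = 0 uniform.
    The proof is Pascal's rule applied to both recurrences of [ballot]. *)
Lemma ballot_reflection (k m : nat) : k < m ->
  ballot k.+1 m + 'C(k + m, m.+1) = 'C(k + m, m).
Proof.
elim: k m => [|k IH] m km.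
  rewrite ballotS // big_ltn ?ltnS ?(ltnW km) // big_nat big1 => [|j /andP[j0 _]].
    by rewrite add0n bin_small // binn.
  by case: j j0.
rewrite -(subnKC km); elim: (m - k.+2) => [|d IHd]; last first.
  rewrite addnS ballot_rec; last lia.
  have := IH (k.+2 + d).+1; rewrite !addSn !addnS !binS in IHd * => /(_ ltac:(lia)).
  lia.
have IH1 := IH k.+1 (leqnn _); have IH2 := IH k.+2 (leqW (leqnn _)).
have sym : 'C(k + k.+1, k.+1) = 'C(k + k.+1, k) by rewrite -bin_sub ?addnK; [|lia].
rewrite addn0 ballot_diag; rewrite !(addSn, addnS) !binS in IH1 IH2 sym *; lia.
Qed.

Lemma ballot_closed (k m : nat) : k < m ->
  m.+1 * ballot k.+1 m = (m.+1 - k) * 'C(k + m, m).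
Proof.
move=> km; have := ballot_reflection km; have := mul_bin_left (k + m) m.
rewrite addnK mulnBl; nia.
Qed.

(** By the closed form the ratio of consecutive entries of row k.+1 is
    (m + 2 - k)(k + m + 1) / ((m + 2)(m + 1 - k)).  Both
    (m + 2 - k) / (m + 1 - k) <= 4/3 and (k + m + 1) / (m + 2) < 2 hold here. *)
Lemma leq_ballot3 (k m : nat) : k < m -> ballot k m.+1 <= 3 * ballot k m.
Proof.
case: k => [|k] km; first by case: m km.
have e1 := ballot_closed (ltnW km); have e2 := ballot_closed (ltnW (leqW km)).
have e3 := mul_bin_diag (k + m).+1 m; rewrite /= in e3; rewrite addnS in e2.
set B := ballot _ _ in e1 *; set B' := ballot _ _ in e2 *.
set X := 'C(_, _) in e1 e3; set Y := 'C(_, _) in e2 e3.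
have e : (m.+1 - k) * (m.+2 * B') = (m.+2 - k) * ((k + m).+1 * B).
  apply/eqP; rewrite -(eqn_pmul2l (ltn0Sn m)); apply/eqP.
  transitivity ((m.+1 - k) * (m.+2 - k) * (m.+1 * Y)); first by rewrite e2; ring.
  transitivity ((m.+2 - k) * (k + m).+1 * (m.+1 * B)); last by ring.
  by rewrite -e3 e1; ring.
have d0 : 0 < (m.+1 - k) * m.+2 by rewrite muln_gt0 subn_gt0; lia.
rewrite -(leq_pmul2l d0) -mulnA e.
have [d em] : exists d, m = k.+2 + d by exists (m - k.+2); lia.
have -> : m.+1 - k = d + 3 by lia.
have -> : m.+2 - k = d + 4 by lia.
rewrite em; nia.
Qed.

Lemma ballot_catalan (n : nat) : n.+1 * ballot n n = 'C(2 * n, n).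
Proof.
case: n => [|k]; first by rewrite /ballot.
have -> : 2 * k.+1 = (k + k.+1).+1 by lia.
have sym : 'C(k + k.+1, k.+1) = 'C(k + k.+1, k).
  by rewrite -[RHS]bin_sub ?addKn //; lia.
rewrite ballot_closed // binS -sym; lia.
Qed.

Lemma ballot_catalanS (n : nat) :
  n.+2 * ballot n.+1 n.+1 = 2 * (2 * n).+1 * ballot n n.
Proof.
apply/eqP; rewrite -(eqn_pmul2l (ltn0Sn n)); apply/eqP.
transitivity (n.+1 * 'C(2 * n.+1, n.+1)); first by rewrite -ballot_catalan.
rewrite mulnCA -mulnA ballot_catalan -mul_bin_diag.
have -> : (2 * n.+1).-1 = (2 * n).+1 by lia.
rewrite -mulnA; congr (_ * _).
have := mul_bin_down (2 * n).+1 n; rewrite /=.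
by have -> : (2 * n).+1 - n = n.+1 by lia.
Qed.

(** * Comparing consecutive strategies *)

Lemma winsS (N k : nat) : k <= N -> wins N.+1 k = wins N k + (N.+1 - k) * ballot k N.
Proof. by move=> kN; rewrite /wins big_nat_recr. Qed.

Lemma wins_last1 (n : nat) : wins n.+1 n = ballot n n.
Proof. by rewrite winsS // /wins big_geq // subSnn mul1n. Qed.

Lemma wins_last2 (n : nat) : wins n.+2 n + ballot n n = 2 * ballot n.+1 n.+1.
Proof.
rewrite winsS // wins_last1 ballot_diag; lia.
Qed.

Lemma wins_last3 (n : nat) :
  wins n.+3 n + 4 * ballot n.+1 n.+1 + ballot n n = 3 * ballot n.+2 n.+2.
Proof.
have := wins_last2 n; have := ballot_diag n.+1; have := ballot_diag n.
rewrite (@winsS n.+2); last lia.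
have := @ballot_rec n n.+1 (leqnn _).
have -> : n.+3 - n = 3 by lia.
lia.
Qed.

Lemma ballot_diag_gt0 (k : nat) : 0 < ballot k k.
Proof.
have : 0 < 'C(2 * k, k) by rewrite bin_gt0; lia.
by rewrite -ballot_catalan; case: (ballot k k); rewrite ?muln0.
Qed.

(** Passing from M to M.+1 adds (M + 1 - k) * [ballot k M] on the left and
    (M - k) * [ballot k.+1 M] on the right.  Since [ballot k.+1 M] contains both
    [ballot k M] and [ballot k M.-1], the increment on the right is the larger one
    as soon as [ballot k M] <= (M - k) * [ballot k M.-1], which [leq_ballot3] gives.
    At N = k + 4 the difference is 5 b0 + 4 b1 + 2 b2 - b3 where
    bi = [ballot k (k + i)], and b3 <= 3 b2 <= 2 b2 + 3 b1. *)
Lemma wins_increasing (N k : nat) : k + 4 <= N -> wins N k < wins N k.+1.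
Proof.
move=> kN; rewrite -(subnKC kN); elim: (N - (k + 4)) => [|d IH].
  have := wins_last3 k; have := wins_last3 k.+1.
  have := @winsS k.+3 k ltac:(lia); have := @leq_ballot3 k k.+2 ltac:(lia).
  have := @leq_ballot3 k k.+1 ltac:(lia); have := ballot_diag k.
  have := ballot_diag k.+1; have := ballot_diag k.+2.
  have := @ballot_rec k k.+1 ltac:(lia); have := @ballot_rec k k.+2 ltac:(lia).
  have := @ballot_rec k.+1 k.+2 ltac:(lia).
  have -> : k.+4 - k = 4 by lia.
  have := ballot_diag_gt0 k; rewrite addn0 addn4; lia.
rewrite addnS winsS; last lia.
rewrite (@winsS _ k.+1); last lia.
set M := k + 4 + d in IH *.
have [M' eM] : exists M', M = M'.+1 by exists (k + 3 + d); lia.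
have kM : k.+2 < M' by lia.
have := @leq_ballot3 k M' ltac:(lia); rewrite -eM => r3.
have : ballot k M + ballot k M' <= ballot k.+1 M.
  rewrite eM ballotS; last lia.
  rewrite big_nat_recr /=; last lia.
  rewrite big_nat_recr /=; lia.
have -> : M.+1 - k = (M - k).+1 by lia.
have -> : M.+1 - k.+1 = M - k by lia.
have : 3 <= M - k by lia.
nia.
Qed.

Lemma ballot_diag_ltn (n : nat) : 0 < n -> ballot n n < ballot n.+1 n.+1.
Proof. by move=> n0; have := ballot_catalanS n; have := ballot_diag_gt0 n; nia. Qed.

Lemma wins_last12 (n : nat) : wins n.+3 n.+2 < wins n.+3 n.+1.
Proof.
have := wins_last1 n.+2; have := wins_last2 n.+1; have := @ballot_diag_ltn n.+1 isT.
lia.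
Qed.

(** Here n = N - 3.  The difference of the two counts is
    C_(n+2) - 3 C_(n+1) - C_n, and expressing everything through C_n turns its
    sign into that of 3 n^2 - 15 n - 12. *)
Lemma wins_last23 (n : nat) :
  if n < 6 then wins n.+3 n < wins n.+3 n.+1 else wins n.+3 n.+1 < wins n.+3 n.
Proof.
have e1 := ballot_catalanS n; have e2 := ballot_catalanS n.+1.
suff : if n < 6 then ballot n.+2 n.+2 < 3 * ballot n.+1 n.+1 + ballot n n
       else 3 * ballot n.+1 n.+1 + ballot n n < ballot n.+2 n.+2.
  by have := wins_last3 n; have := wins_last2 n.+1; case: ifP; lia.
have s0 : 0 < n.+3 * n.+2 by [].
rewrite -[ballot _ _ < _](ltn_pmul2l s0) -[_ + _ < ballot _ _](ltn_pmul2l s0).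
have -> : n.+3 * n.+2 * ballot n.+2 n.+2 =
  2 * (2 * n.+1).+1 * (2 * (2 * n).+1) * ballot n n.
  by rewrite [LHS]mulnAC e2 -[RHS]mulnA -e1; ring.
have -> : n.+3 * n.+2 * (3 * ballot n.+1 n.+1 + ballot n n) =
  (3 * n.+3 * (2 * (2 * n).+1) + n.+3 * n.+2) * ballot n n.
  by rewrite mulnDl -[3 * _ * _ * _]mulnA -e1; ring.
rewrite !(ltn_pmul2r (ballot_diag_gt0 n)); case: ltnP => n6; nia.
Qed.

Lemma wins_before_last3 (n k : nat) : k < n -> wins n.+3 k < wins n.+3 n.
Proof.
move=> kn; have [d e] : exists d, n = k + d.+1 by exists (n - k.+1); lia.
elim: d k {kn} e => [|d IH] k e; first by rewrite e addn1; apply: wins_increasing; lia.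
by apply: ltn_trans (IH k.+1 _); [apply: wins_increasing; lia | lia].
Qed.

Lemma wins_lt_k_opt (N k : nat) : 3 <= N -> k < N -> k != k_opt N ->
  wins N k < wins N (k_opt N).
Proof.
move=> N3 kN; have -> : N = (N - 3).+3 by lia.
have : k < (N - 3).+3 by lia.
move: (N - 3) => n {N N3 kN} kn.
have -> : k_opt n.+3 = if n < 6 then n.+1 else n.
  by rewrite /k_opt; case: (ltnP n 6); do !case: ifP; lia.
have w23 := wins_last23 n; have w12 := wins_last12 n.
have wk := @wins_before_last3 n k.
have kE : [\/ k < n, k = n, k = n.+1 | k = n.+2].
  have [kn'|kn'|->] := ltngtP k n; [by constructor 1| |by constructor 2].
  by have [kn''|kn''|->] := ltngtP k n.+1; [lia|constructor 4; lia|constructor 3].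
by case: ltnP w23 => _ w23; case: kE => [/wk|->|->|->]; rewrite ?eqxx //; lia.
Qed.

(** * Success probabilities and their limit *)

Import Order.TTheory GRing.Theory Num.Theory.
Import numFieldNormedType.Exports.
Local Open Scope classical_set_scope.
Local Open Scope ring_scope.

Lemma catalanE (R : realType) (n : nat) : catalan R n = (ballot n n)%:R.
Proof. by rewrite /catalan -ballot_catalan natrM mulKf ?pnatr_eq0. Qed.

Lemma success_probE (R : realType) (N k : nat) : (k < N)%N ->
  success_prob R N k = (wins N k)%:R / (ballot N N)%:R.
Proof. by move=> kN; rewrite /success_prob card_winnable // catalanE. Qed.

Lemma ler_success_prob (R : realType) (N j k : nat) : (j < N)%N -> (k < N)%N ->
  (success_prob R N j <= success_prob R N k) = (wins N j <= wins N k)%N.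
Proof.
move=> jN kN; rewrite !success_probE // ler_pM2r ?ler_nat //.
by rewrite invr_gt0 ltr0n ballot_diag_gt0.
Qed.

Lemma k_opt_optimal (R : realType) (N : nat) : (2 <= N)%N -> optimal R N (k_opt N).
Proof.
move=> N2; have kN : (k_opt N < N)%N by rewrite /k_opt; do !case: ifP; lia.
split=> [|k kN']; first lia.
rewrite ler_success_prob //; last lia.
have [N3|N3] := ltnP 2 N; last first.
  (* For N = 2 both strategies win exactly once. *)
  have -> : N = 2%N by lia.
  rewrite wins_last1; case: k kN' => [|[|k]]; rewrite ?wins_last1 //; last lia.
  by move=> _; have := wins_last2 0; have := ballot_diag 0; rewrite /ballot /=; lia.
have [->//|kk] := eqVneq k (k_opt N).
by apply/ltnW/wins_lt_k_opt; lia.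
Qed.

Lemma k_opt_unique (R : realType) (N k : nat) : (3 <= N)%N ->
  optimal R N k -> k = k_opt N.
Proof.
move=> N3 [kN opt]; have [//|kk] := eqVneq k (k_opt N).
have kN' : (k < N)%N by lia.
have oN : (k_opt N < N)%N by rewrite /k_opt; do !case: ifP; lia.
have := opt (k_opt N); rewrite ler_success_prob //; have := wins_lt_k_opt N3 kN' kk.
lia.
Qed.

Lemma success_prob_k_opt (R : realType) (N : nat) : (9 <= N)%N ->
  success_prob R N (k_opt N) =
  (3 * catalan R (N - 1) - 4 * catalan R (N - 2) - catalan R (N - 3)) / catalan R N.
Proof.
move=> N9; have -> : k_opt N = (N - 3)%N.
  by rewrite /k_opt; do !case: ifP; lia.
rewrite success_probE ?(catalanE R); last lia.
congr (_ / _); have -> : N = (N - 3).+3 by lia.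
move: (N - 3)%N => n; rewrite !subSS !subn0.
have /(congr1 (fun i => i%:R : R)) := wins_last3 n.
by rewrite !(natrM, natrD); lra.
Qed.

(** C_n / C_(n+1) = (n + 2) / (2 (2 n + 1)) = 1/4 + (3/4) / (2 n + 1). *)
Lemma cvg_catalan_ratio (R : realType) :
  (fun n : nat => catalan R n / catalan R n.+1) @ \oo --> (1 / 4 : R).
Proof.
have -> : (fun n : nat => catalan R n / catalan R n.+1) =
  (fun n => 1 / 4 + 3 / 4 * (2 * n%:R + 1)^-1).
  apply/funext=> n; rewrite !catalanE.
  have /(congr1 (fun i => i%:R : R)) := ballot_catalanS n.
  rewrite !natrM -(natr1 (2 * n)%N) natrM -(natr1 n.+1) -(natr1 n) => e.
  have c1 : (ballot n.+1 n.+1)%:R != 0 :> R by rewrite pnatr_eq0 -lt0n ballot_diag_gt0.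
  have n0 : 2 * n%:R + 1 != 0 :> R by rewrite gt_eqF // ltr_wpDl // mulr_ge0.
  apply: (mulIf c1); rewrite divfK //; apply: (mulfI n0).
  have -> : (2 * n%:R + 1) * ((1 / 4 + 3 / 4 * (2 * n%:R + 1)^-1) * (ballot n.+1 n.+1)%:R)
    = ((2 * n%:R + 1) / 4 + 3 / 4) * (ballot n.+1 n.+1)%:R :> R by field.
  by lra.
rewrite -[X in _ --> X]addr0; apply: cvgD; first exact: cvg_cst.
rewrite -[X in _ --> X](mulr0 (3 / 4)); apply: cvgMr.
apply: (@squeeze_cvgr _ _ _ _ (fun=> 0) (@harmonic R)) (@cvg_harmonic R); last exact: cvg_cst.
apply: nearW => n; rewrite /harmonic /=.
have n0 : 0 <= n%:R :> R by [].
rewrite invr_ge0 lef_pV2 ?posrE ?ltr0n //; last lra.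
by rewrite -natr1; apply/andP; split; lra.
Qed.

Lemma cvg_catalan_formula (R : realType) :
  (fun N : nat =>
     (3 * catalan R (N - 1) - 4 * catalan R (N - 2) - catalan R (N - 3))
       / catalan R N) @ \oo --> (31 / 64 : R).
Proof.
(* With N = n + 3 the expression is a polynomial in three consecutive ratios. *)
rewrite -(cvg_shiftn 3).
pose r n := catalan R n / catalan R n.+1.
have cn (n : nat) : catalan R n != 0.
  by rewrite catalanE pnatr_eq0 -lt0n ballot_diag_gt0.
have -> : [sequence ((3 * catalan R (n + 3 - 1) - 4 * catalan R (n + 3 - 2)
         - catalan R (n + 3 - 3))
       / catalan R (n + 3))]_n =
  (fun n => 3 * r (n + 2)%N - 4 * (r (n + 2)%N * r (n + 1)%N) - r (n + 2)%N * r (n + 1)%N * r n).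
  apply/funext=> n; rewrite /r /mk_sequence addn3 addn2 addn1 !subSS !subn0.
  field; rewrite !cn //.
have r0 : r @ \oo --> (1 / 4 : R) := @cvg_catalan_ratio R.
have r1 : (fun n => r (n + 1)%N) @ \oo --> (1 / 4 : R) by rewrite (cvg_shiftn 1 r).
have r2 : (fun n => r (n + 2)%N) @ \oo --> (1 / 4 : R) by rewrite (cvg_shiftn 2 r).
have -> : 31 / 64 = 3 * (1 / 4) - 4 * (1 / 4 * (1 / 4)) - 1 / 4 * (1 / 4) * (1 / 4) :> R.
  by field.
apply: cvgB; last by apply: cvgM => //; apply: cvgM.
by apply: cvgB; apply: cvgMr => //; apply: cvgM.
Qed.

Theorem corollary4p10 (R : realType) :
  [/\ forall N : nat, (2 <= N)%N ->
        optimal R N (k_opt N) /\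
        ((3 <= N)%N -> forall k : nat, optimal R N k -> k = k_opt N),
      (fun N : nat => success_prob R N (k_opt N)) @ \oo --> (31 / 64 : R),
      (fun N : nat =>
         (3 * catalan R (N - 1) - 4 * catalan R (N - 2) - catalan R (N - 3))
           / catalan R N) @ \oo --> (31 / 64 : R)
    & 31 / 64 = 484 / 10 ^+ 3 + 375 / 10 ^+ 6 :> R].
Proof.
split; last by field.
- move=> N N2; split; first exact: k_opt_optimal.
  by move=> N3 k; apply: k_opt_unique.
- apply: (cvg_trans _ (cvg_catalan_formula (R := R))); apply: near_eq_cvg.
  by exists 9%N => // N /= N9; rewrite success_prob_k_opt.
- exact: cvg_catalan_formula.
Qed.
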